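(* Let $A$ be a finite totally ordered alphabet with at least two elements. Let $\Sigma=\bigcup_{n\ge 0}S_n(A)$ be the set of all $n$-superdips ($n\ge 0$), and let $Z$ be the Lazard set associated with the order $\prec$ on nonempty words. Then for any odd integer $m\ge 1$, $$\Sigma\cap A^m=Z\cap A^m .$$
   Context: Words: $A^*$ is the set of words on $A$, $A^+$ the nonempty words, $A^{\le n}$ the words of length at most $n$, $|w|$ the length of $w$. For $X\subset A^*$, $X^*$ (resp. $X^+$) is the set of products of finitely many (resp. finitely many, at least one) elements of $X$. Radix order on $A^*$: $u<v$ if $|u|<|v|$, or $|u|=|v|$ and $u$ precedes $v$ lexicographically. Dips and superdips: for a totally ordered set (alphabet) $B$ with at least two elements, $D(B)=\{b_1b_2\cdots b_n\mid b_i\in B,\ n\ge 2,\ b_1\ge b_2\ge\dots\ge b_{n-1}<b_n\}$ (dips), and $S(B)$ (superdips) is the set of words over $B$ formed of a dip of odd length (over $B$) followed by a possibly empty sequence of dips of even length (over $B$). Define $S_0(A)=A$ and, for $n\ge1$, $D_n(A)=D(S_{n-1}(A))$, $S_n(A)=S(S_{n-1}(A))$, where $S_{n-1}(A)$ is viewed as an alphabet totally ordered by the restriction of the radix order of $A^*$; $S_{n-1}(A)$ is a code, so words over the alphabet $S_{n-1}(A)$ are identified with words over $A$, and $D_n(A),S_n(A)\subset A^+$. Index: let $P_n(A)$ be the set of proper prefixes (including the empty word) of words of $D_n(A)$. One has $A^*\supset D_1(A)^+P_1(A)\supset D_2(A)^+P_2(A)\supset\cdots$. The index $\mathrm{index}(w)$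 is the largest $n\ge 1$ such that $w\in D_n(A)^+P_n(A)$, and is $0$ if there is no such $n$. Order $\prec$ on $A^+$: $x\prec y$ if (i) $|x|$ is odd and $|y|$ is even, or (ii) $|x|,|y|$ have the same parity and either $\mathrm{index}(x)<\mathrm{index}(y)$, or $\mathrm{index}(x)=\mathrm{index}(y)$ and $x<y$ in the radix order. Lazard set: a totally ordered set $Z\subset A^+$ is a Lazard set if for every $n\ge1$, writing $Z\cap A^{\le n}=\{z_1,\dots,z_k\}$ with $z_1<z_2<\dots<z_k$ in the order of $Z$, and defining $Z_1=A$, $Z_{i+1}=z_i^*(Z_i\setminus\{z_i\})$ for $1\le i\le k$, one has $z_i\in Z_i$ for $1\le i\le k$ and $Z_{k+1}\cap A^{\le n}=\emptyset$. The Lazard set associated with $\prec$ is the unique Lazard set whose order is the restriction of $\prec$ (it exists and is unique). *)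

(* Defs.v *)
From mathcomp Require Import all_boot all_order.
From mathcomp Require Export boolp classical_sets.

Set Implicit Arguments.
Unset Strict Implicit.
Unset Printing Implicit Defensive.

Local Open Scope classical_set_scope.

Section Languages.
Variable A : eqType.
Implicit Types X Y : set (seq A).

Definition letters : set (seq A) := [set [:: a] | a in [set: A]].

Definition lang_cat X Y : set (seq A) := [set u ++ v | u in X & v in Y].

Definition lang_star X : set (seq A) :=
  [set flatten s | s in [set s | [set` s] `<=` X]].

Definition lang_plus X : set (seq A) :=
  [set flatten s | s in [set s | s != [::] /\ [set` s] `<=` X]].

Definition words_of_length (m : nat) : set (seq A) := [set w | size w = m].

Definition words_upto (n : nat) : set (seq A) := [set w | size w <= n].

End Languages.

Section DipsOverOrderedAlphabet.
Variables (T : eqType) (lt : rel T) (B : set T).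

Definition dips : set (seq T) :=
  [set s | [set` s] `<=` B /\
     exists t x y, [/\ s = rcons (rcons t x) y,
       sorted (fun u v => (u == v) || lt v u) (rcons t x) & lt x y]].

Definition superdips : set (seq T) :=
  [set d ++ flatten ds |
     d in [set d | dips d /\ odd (size d)]
   & ds in [set ds | forall e, e \in ds -> dips e /\ ~~ odd (size e)]].

End DipsOverOrderedAlphabet.

Section Words.
Variables (disp : Order.disp_t) (A : finOrderType disp).
Implicit Types u v w x y : seq A.

Definition radix_lt : rel (seq A) := fun u v =>
  (size u < size v) ||
  ((size u == size v) && (u < v :> seqlexi A)%O).

(* A word over the alphabet [nsuperdip n'] is a value of type [seq (seq A)];
   [flatten] identifies it with a word over A, and this is injective on such
   words because [nsuperdip n'] is a code.  The lengths constrained in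
   [superdips] are lengths over [nsuperdip n']. *)
Fixpoint nsuperdip (n : nat) : set (seq A) :=
  if n is n'.+1 then
    [set flatten s | s in superdips radix_lt (nsuperdip n')]
  else @letters A.

(* Only meaningful for n >= 1. *)
Definition ndip (n : nat) : set (seq A) :=
  [set flatten s | s in dips radix_lt (nsuperdip n.-1)].

Definition ndip_prefix (n : nat) : set (seq A) :=
  [set p | exists2 w, ndip n w & prefix p w && (p != w)].

Definition ndip_level (n : nat) : set (seq A) :=
  lang_cat (lang_plus (ndip n)) (ndip_prefix n).

(* [xget 0 P] is an element of P (here necessarily unique) if there is one,
   and 0 otherwise. *)
Definition word_index w : nat :=
  xget 0 [set n | [/\ 1 <= n, ndip_level n w &
                      forall k, 1 <= k -> ndip_level k w -> k <= n]].

Definition prec : rel (seq A) := fun x y =>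
  (odd (size x) && ~~ odd (size y)) ||
  ((odd (size x) == odd (size y)) &&
   ((word_index x < word_index y) ||
    ((word_index x == word_index y) && radix_lt x y))).

Definition strict_total_order_on (lt : rel (seq A)) (Z : set (seq A)) : Prop :=
  [/\ forall x, Z x -> ~~ lt x x,
      forall x y z, Z x -> Z y -> Z z -> lt x y -> lt y z -> lt x z &
      forall x y, Z x -> Z y -> [\/ lt x y, x = y | lt y x]].

Definition lazard_elim (X : set (seq A)) (z : seq A) : set (seq A) :=
  lang_cat (lang_star [set z]) (X `\ z).

(* With zs = [:: z_1; ...; z_k], [lazard_stage zs i] is Z_(i+1). *)
Definition lazard_stage (zs : seq (seq A)) (i : nat) : set (seq A) :=
  foldl lazard_elim (@letters A) (take i zs).

Definition lazard_set (lt : rel (seq A)) (Z : set (seq A)) : Prop :=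
  [/\ forall z, Z z -> z != [::],
      strict_total_order_on lt Z &
      forall n, 1 <= n -> exists zs : seq (seq A),
        [/\ [set` zs] = Z `&` @words_upto A n,
            sorted lt zs,
            forall i, i < size zs -> lazard_stage zs i (nth [::] zs i) &
            lazard_stage zs (size zs) `&` @words_upto A n = set0]].

End Words.

(* Main.v *)
(* Let X_0 = A and let O_n, E_n be the words of odd and even length in the
   prefix code X_n. Then S_n(A) = O_n E_n^*, and eliminating S_n(A) in radix
   order from X_n leaves X_{n+1} = E_n + R_{n+1}, where R_{n+1} consists of the
   dips b_1 >= .. >= b_{k-1} < b_k over S_n(A) such that b_k is in O_n or b_k = pe
   with e in E_n and p <= b_{k-1}; indeed D_{n+1}(A) = R_{n+1} E_n^*.
   Because X_n is a prefix code, elements of S_n(A) have index exactly n, whereas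
   elements of D_{n+1}(A) have index greater than n. Since z_i is necessarily the
   least element of Z_i for the order on Z, on words of bounded length the
   elimination runs through S_0(A), S_1(A), ... in turn, each in radix order, and
   reaches words of even length only once no word of odd length is left. *)
Require Import Defs.
From mathcomp Require Import all_boot all_order.
From mathcomp Require Import boolp classical_sets.
From mathcomp Require Import zify.

Set Implicit Arguments.
Unset Strict Implicit.
Unset Printing Implicit Defensive.

Local Open Scope classical_set_scope.

(** * The radix order as a strict total order *)

Section Radix.
Variables (disp : Order.disp_t) (A : finOrderType disp).
Implicit Types u v w : seq A.

Lemma radix_irr u : ~~ radix_lt u u.
Proof. by rewrite /radix_lt ltnn Order.POrderTheory.ltxx andbF. Qed.

Lemma radix_trans : transitive (@radix_lt disp A).
Proof.
move=> v u w /orP[uv|/andP[/eqP uv luv]] /orP[vw|/andP[/eqP vw lvw]].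
- by rewrite /radix_lt (ltn_trans uv vw).
- by rewrite /radix_lt -vw uv.
- by rewrite /radix_lt uv vw.
- rewrite /radix_lt uv vw eqxx (Order.POrderTheory.lt_trans luv lvw).
  by rewrite orbT.
Qed.

Lemma radix_total u v : [\/ radix_lt u v, u = v | radix_lt v u].
Proof.
rewrite /radix_lt; case: (ltngtP (size u) (size v)) => //= _;
  try by [constructor 1|constructor 3].
by case: (Order.TotalTheory.ltgtP (u : seqlexi A) v) => h;
  [constructor 1|constructor 3|constructor 2].
Qed.

Lemma radix_cat u v : v != [::] -> radix_lt u (u ++ v).
Proof.
by case: v => //= a v _; rewrite /radix_lt size_cat /=; apply/orP; left; lia.
Qed.

Lemma radix_asym u v : radix_lt u v -> radix_lt v u = false.
Proof.
move=> uv; apply: contraNF (radix_irr u) => vu; exact: radix_trans uv vu.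
Qed.

Definition radix_ge u v := (u == v) || radix_lt v u.

Lemma radix_geP u v : radix_ge u v = ~~ radix_lt u v.
Proof.
rewrite /radix_ge; case: (radix_total u v) => [h|->|h].
- rewrite h (radix_asym h) orbF; apply: contraTF h => /eqP ->.
  exact: radix_irr.
- by rewrite eqxx (radix_irr v).
- by rewrite h (radix_asym h) orbT.
Qed.

End Radix.

(** * Prefix codes and unique factorisation *)

Section Prefix.
Variable A : eqType.
Implicit Types (X : set (seq A)) (u v w : seq A).

Definition prefix_free X := forall x y, X x -> X y -> prefix x y -> x = y.

(** The bound is there because [code n] is compared with a stage of the elimination on short words
    only. *)
Definition prefix_free_upto N X :=
  forall x y, X x -> X y -> size y <= N -> prefix x y -> x = y.

Lemma prefix_comparable u v w :
  prefix u w -> prefix v w -> prefix u v \/ prefix v u.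
Proof.
move=> /prefixP[r ->]; elim: u v r => [|a u IH] [|b v] r //=; try by [left|right].
by case: (b =P a) => //= -> /IH; rewrite eqxx.
Qed.

(** Both first factors are prefixes of the same word, hence comparable, hence equal; cancel them and
    repeat. *)
Lemma prefix_free_flatten N X s t r :
    (forall x, X x -> x != [::]) -> prefix_free_upto N X ->
    [set` s] `<=` X -> [set` t] `<=` X ->
  size (flatten s) <= N -> flatten s = flatten t ++ r ->
  exists s', s = t ++ s'.
Proof.
move=> X0 pX; elim: t s => [|y t IH] [|x s] sX tX /=; rewrite ?size_cat.
- by exists [::].
- by exists (x :: s).
- have /X0 : X y by apply: tX; rewrite /= inE eqxx.
  by case: (y).
- have Xy : X y by apply: tX; rewrite /= inE eqxx.
  have Xx : X x by apply: sX; rewrite /= inE eqxx.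
  move=> sN; rewrite -catA => e.
  have szy : size y <= N.
    have : size (x ++ flatten s) <= N by rewrite size_cat.
    by rewrite e !size_cat; lia.
  have szx : size x <= N by lia.
  have xy : x = y.
    have h1 : prefix x (x ++ flatten s) by exact: prefix_prefix.
    have h2 : prefix y (x ++ flatten s) by rewrite e prefix_prefix.
    by case: (prefix_comparable h1 h2) => /pX; [apply|move=> h; symmetry; apply: h].
  move: e; rewrite xy => /eqP; rewrite eqseq_cat // eqxx /= => /eqP e.
  have sN' : size (flatten s) <= N by lia.
  have [a h|a h|s' ->] := IH s _ _ sN' e.
  - by apply: sX; rewrite /= inE h orbT.
  - by apply: tX; rewrite /= inE h orbT.
  by exists s'.
Qed.

End Prefix.

(** * Lazard elimination in a prefix code *)

Section Elim.
Variables (disp : Order.disp_t) (A : finOrderType disp).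
Implicit Types (X Y : set (seq A)) (u v w : seq A).

Lemma lang_elimP X z w : lazard_elim X z w <->
  exists j x, [/\ w = flatten (nseq j z) ++ x, X x & x <> z].
Proof.
split.
- case=> _ [s hs <-] [x [Xx xz] <-]; exists (size s), x; split=> //.
  congr (flatten _ ++ _); apply/all_pred1P/allP => y /hs /= ->.
  exact: eqxx.
- case=> j [x [-> Xx xz]]; exists (flatten (nseq j z)); last by exists x.
  by exists (nseq j z) => // y /=; rewrite mem_nseq => /andP[_ /eqP].
Qed.

(** No other element of [X] is prefix-comparable with a word beginning with [z], so comparable words
    of the new set begin with equally many copies of [z], which cancel. *)
Lemma prefix_free_elim X z : X z -> prefix_free X -> prefix_free (lazard_elim X z).
Proof.
move=> Xz pX.
have key x r : X x -> x <> z -> ~ prefix x (z ++ r) /\ ~ prefix (z ++ r) x.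
  move=> Xx xz; split => h.
  - case: (prefix_comparable h (prefix_prefix z r)) => /pX.
      by move=> /(_ Xx Xz).
    by move=> /(_ Xz Xx)/esym.
  - by apply/xz/esym/pX => //; exact: catl_prefix h.
move=> w1 w2 /lang_elimP[i [x [-> Xx xz]]] /lang_elimP[j [y [-> Xy yz]]].
elim: i j => [|i IH] [|j] //=.
- exact: pX.
- by rewrite -catA => h; case: (key x (flatten (nseq j z) ++ y) Xx xz).
- by rewrite -catA => h; case: (key y (flatten (nseq i z) ++ x) Xy yz).
- by rewrite -!catA prefix_catr // eqxx /= => /IH ->.
Qed.

End Elim.

(** * The codes behind the superdips *)

Section Blocks.
Variables (disp : Order.disp_t) (A : finOrderType disp).
Local Notation word := (seq A).
Implicit Types (X L P : set word) (u v w x b p e : word).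

Definition odd_part X : set word := [set x | X x /\ odd (size x)].
Definition even_part X : set word := [set x | X x /\ ~~ odd (size x)].

(** For [X] = [code n] these are the n-superdips, by [nsuperdipE]. *)
Definition blocks X : set word :=
  lang_cat (odd_part X) (lang_star (even_part X)).

(* The elements of [blocks X] present in the code once the elements of [P] have
   been eliminated: [o e1 .. ej] appears when [o e1 .. e(j-1)] is eliminated. *)
Definition fresh X P : set word := odd_part X `|` lang_cat P (even_part X).

(* The constraint on the last letter of a dip that survives in the code: its
   parent must have been eliminated no later than [x]. *)
Definition narrow X x : set word :=
  fresh X [set p | blocks X p /\ radix_ge x p].

(* [descent L Q b w]: w = b1 b2 .. bk v with b = b1 >= .. >= bk in [L], k >= 1,
   bk < v and [Q bk v]; dips over [L] are the case where [Q] says v \in L. *)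
Inductive descent L (Q : word -> set word) : word -> set word :=
| descent_base x v : L x -> Q x v -> radix_lt x v -> descent L Q x (x ++ v)
| descent_step b x w :
    L b -> radix_ge b x -> descent L Q x w -> descent L Q b (b ++ w).

Definition dip_words L : set word := [set w | exists b, descent L (fun=> L) b w].

(* The code obtained from the prefix code [X] by eliminating an initial segment
   [L] (for the radix order) of [blocks X]. *)
Definition partial X L : set word :=
  even_part X `|` (fresh X L `\` L) `|`
  [set w | exists b, descent L (narrow X) b w].

Fixpoint code n : set word :=
  if n is n'.+1 then partial (code n') (blocks (code n')) else @letters A.

Lemma even_star X w : lang_star (even_part X) w -> ~~ odd (size w).
Proof.
case=> s hs <-; elim: s hs => //= x s IH hs.
rewrite size_cat oddD (negbTE (IH _)); last first.
  by move=> y ys; apply: hs; rewrite /= inE ys orbT.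
by have [_ /negbTE ->] : even_part X x by apply: hs; rewrite /= inE eqxx.
Qed.

Lemma lang_star0 X : lang_star X [::].
Proof. by exists [::]. Qed.

Lemma lang_star1 X x : X x -> lang_star X x.
Proof.
move=> Xx; exists [:: x]; last by rewrite /= cats0.
by move=> y /=; rewrite inE => /eqP ->.
Qed.

Lemma lang_star_cat X u v : lang_star X u -> lang_star X v -> lang_star X (u ++ v).
Proof.
case=> s hs <- [t ht <-]; exists (s ++ t); last by rewrite flatten_cat.
by move=> y /=; rewrite mem_cat => /orP[/hs|/ht].
Qed.

Lemma lang_star_sub X Y w : X `<=` Y -> lang_star X w -> lang_star Y w.
Proof. by move=> XY [s hs <-]; exists s => // y /hs/XY. Qed.

Lemma lang_star_rind X (P : word -> Prop) :
    P [::] -> (forall u x, lang_star X u -> P u -> X x -> P (u ++ x)) ->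
  forall w, lang_star X w -> P w.
Proof.
move=> P0 PS _ [s hs <-]; elim/last_ind: s hs => //= s x IH hs.
have hs' : [set` s] `<=` X.
  by move=> y ys; apply: hs; rewrite /= mem_rcons inE ys orbT.
rewrite flatten_rcons; apply: PS; [by exists s|exact: IH|].
by apply: hs; rewrite /= mem_rcons inE eqxx.
Qed.

Lemma odd_blocks X w : blocks X w -> odd (size w).
Proof.
case=> o [_ oo] [es /even_star ees <-].
by rewrite size_cat oddD oo (negbTE ees).
Qed.

Lemma blocks_odd_part X o : odd_part X o -> blocks X o.
Proof.
by move=> Xo; exists o => //; exists [::]; rewrite ?cats0 //; exact: lang_star0.
Qed.

Lemma blocks_cat_star X b e :
  blocks X b -> lang_star (even_part X) e -> blocks X (b ++ e).
Proof.
case=> o Xo [es hes <-] he; exists o => //; exists (es ++ e); last by rewrite catA.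
exact: lang_star_cat.
Qed.

Lemma blocks_cat X b e : blocks X b -> even_part X e -> blocks X (b ++ e).
Proof. by move=> Sb /lang_star1; exact: blocks_cat_star. Qed.

Lemma fresh_blocks X P v : P `<=` blocks X -> fresh X P v -> blocks X v.
Proof.
move=> PS [/blocks_odd_part //|[p /PS Sp [e Ee <-]]].
exact: blocks_cat.
Qed.

Lemma narrow_blocks X x v : narrow X x v -> blocks X v.
Proof. by apply: fresh_blocks => p []. Qed.

Lemma descent_head L Q b w : descent L Q b w -> L b.
Proof. by case. Qed.

Lemma descent_neq0 L Q b w : descent L Q b w -> w != [::].
Proof.
elim=> [x v _ _|c x w' _ _ _ h].
- by case: v => [|a v]; rewrite ?cats0; case: x.
- by case: c => //=; case: w' h.
Qed.

Lemma descent_sub L Q L' Q' b w : L `<=` L' -> (forall x, Q x `<=` Q' x) ->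
  descent L Q b w -> descent L' Q' b w.
Proof.
move=> LL QQ; elim=> [x v Lx /QQ Qv xv|c x w' Lc cx _ IH].
- by apply: descent_base => //; exact: LL.
- by apply: descent_step IH => //; exact: LL.
Qed.

Lemma partial_blocksE X : partial X (blocks X) =
  even_part X `|` [set w | exists b, descent (blocks X) (narrow X) b w].
Proof.
rewrite /partial; suff -> : fresh X (blocks X) `\` blocks X = set0 by rewrite setU0.
by apply/seteqP; split=> // v [/fresh_blocks h] []; apply: h.
Qed.

Lemma partial0 X : partial X set0 = X.
Proof.
apply/seteqP; split=> [w [[[]//|[[[]//|[? []]] _]]|[b /descent_head []]]|w Xw].
left; case: (boolP (odd (size w))) => ow; [right|left]; by split=> //; left.
Qed.

Lemma partial_neq0 X L : L `<=` blocks X -> (forall x, X x -> x != [::]) ->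
  forall w, partial X L w -> w != [::].
Proof.
move=> LS X0 w [[[/X0 //]|[/(fresh_blocks LS)/odd_blocks]]|[b /descent_neq0 //]].
by case: (w).
Qed.

Lemma code_neq0 n w : code n w -> w != [::].
Proof.
elim: n w => [|n IH] w /=; first by case=> a _ <-.
exact: partial_neq0.
Qed.

(* Appending even code words to the last block, and conversely shortening the
   last block to its least prefix [o e1 .. ej] that exceeds the previous one. *)
Lemma descent_blocksP X b w : (forall x, X x -> x != [::]) ->
  descent (blocks X) (fun=> blocks X) b w <->
  exists r e, [/\ descent (blocks X) (narrow X) b r,
    lang_star (even_part X) e & w = r ++ e].
Proof.
move=> X0; split=> [|[r [e [hb he ->]]]].
- elim=> [x v Sx [o Xo [es hes <-]]|c x w' Sc cx _ [r [e [hr he ->]]]]; last first.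
    by exists (c ++ r), e; rewrite catA; split=> //; exact: descent_step hr.
  elim/lang_star_rind: es / hes => [|es e hes IH Ee].
    rewrite cats0 => xo; exists (x ++ o), [::]; rewrite cats0; split=> //.
      by apply: descent_base => //; left.
    exact: lang_star0.
  rewrite catA => xv; case: (boolP (radix_lt x (o ++ es))) => [|hx].
    move=> /IH[r [f [hr hf def_w]]]; exists r, (f ++ e); split=> //.
      by apply: lang_star_cat => //; exact: lang_star1.
    by rewrite catA -def_w !catA.
  exists (x ++ (o ++ es) ++ e), [::]; rewrite cats0; split=> //; last exact: lang_star0.
  apply: descent_base => //; right; exists (o ++ es); last by exists e.
  by split; [exists o => //; exists es|rewrite radix_geP].
- elim: hb => [x v Sx /narrow_blocks Sv xv|c x w' Sc cx _ IH]; last first.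
    by rewrite -catA; exact: descent_step IH.
  rewrite -catA; apply: descent_base => //; first exact: blocks_cat_star.
  case: (e =P [::]) => [->|/eqP e0]; first by rewrite cats0.
  exact: radix_trans xv (radix_cat _ e0).
Qed.

(** * Dips and superdips in terms of descents and blocks *)

Lemma dips_cons L b x s :
  L b -> radix_ge b x -> dips (@radix_lt _ A) L (x :: s) ->
  dips (@radix_lt _ A) L (b :: x :: s).
Proof.
move=> Lb bx [sL [t [y [z [e st yz]]]]]; split.
  by move=> c /=; rewrite inE => /orP[/eqP -> //|/sL].
exists (b :: t), y, z; split => //; first by rewrite e.
case: t e st => [|c t] /= [<- _] st; apply/andP; split => //.
Qed.

Lemma descent_dips L b w : descent L (fun=> L) b w ->
  exists s, dips (@radix_lt _ A) L (b :: s) /\ flatten (b :: s) = w.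
Proof.
elim=> [x v Lx Lv xv|c x w' Lc cx _ [s [ds <-]]]; last first.
  by exists (x :: s); split=> //; exact: dips_cons.
exists [:: v]; rewrite /= cats0; split=> //; split; last by exists [::], x, v.
by move=> y /=; rewrite !inE => /orP[/eqP ->|/eqP ->].
Qed.

Lemma dips_descent L d : dips (@radix_lt _ A) L d ->
  exists b, descent L (fun=> L) b (flatten d).
Proof.
case=> sL [t [x [y [def_d st xy]]]]; rewrite {d}def_d in sL *.
suff h : descent L (fun=> L) (head x (rcons t x))
                 (flatten (rcons (rcons t x) y)) by eexists; exact: h.
elim: t sL st => [|b t IH] sL st /=.
  by rewrite cats0; apply: descent_base => //; apply: sL; rewrite /= !inE eqxx ?orbT.
have Lb : L b by apply: sL; rewrite /= inE eqxx.
have /IH : [set` rcons (rcons t x) y] `<=` L.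
  by move=> z /= hz; apply: sL; rewrite /= inE hz orbT.
move=> /(_ (path_sorted st)); apply: descent_step => //.
by move: st; case: (t) => [|c t'] /= /andP[].
Qed.

(** Lets the parity conditions on superdips, stated over the alphabet [L], be read on words over
    [A]. *)
Lemma odd_flatten L s : (forall x, L x -> odd (size x)) -> [set` s] `<=` L ->
  odd (size (flatten s)) = odd (size s).
Proof.
move=> Lodd; elim: s => //= x s IH sL; rewrite size_cat oddD IH.
  by rewrite Lodd //; apply: sL; rewrite /= inE eqxx.
by move=> y ys; apply: sL; rewrite /= inE ys orbT.
Qed.

Lemma superdips_flattenE L : (forall x, L x -> odd (size x)) ->
  [set flatten s | s in superdips (@radix_lt _ A) L] = blocks (dip_words L).
Proof.
move=> Lodd.
have fl d : dips (@radix_lt _ A) L d ->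
    dip_words L (flatten d) /\ odd (size (flatten d)) = odd (size d).
  move=> dd; split; first by have [b ?] := dips_descent dd; exists b.
  by apply: odd_flatten Lodd _; case: dd.
have lf w : dip_words L w ->
    exists2 d, dips (@radix_lt _ A) L d /\ odd (size d) = odd (size w) & flatten d = w.
  move=> [b /descent_dips[s [ds def_w]]]; exists (b :: s) => //; split=> //.
  by have [_ <-] := fl _ ds; rewrite def_w.
apply/seteqP; split=> [_ [_ [d [dd od] [ds hds <-]] <-]|_ [o [/lf[d [dd <-] <-] od] [e he <-]]].
- rewrite flatten_cat; have [h1 h2] := fl _ dd.
  exists (flatten d); first by split; rewrite ?h2.
  exists (flatten (flatten ds)) => //; exists (map flatten ds).
    move=> _ /= /mapP[c /hds[dc ec] ->]; have [h3 h4] := fl _ dc.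
    by split; rewrite ?h4.
  by elim: (ds) => //= c s ->; rewrite flatten_cat.
- suff [ds hds <-] : exists2 ds,
      (forall c, c \in ds -> dips (@radix_lt _ A) L c /\ ~~ odd (size c)) &
      flatten (flatten ds) = e.
    exists (d ++ flatten ds); last by rewrite flatten_cat.
    by exists d => //; exists ds.
  elim/lang_star_rind: e / he => [|u x _ [ds hds <-] [/lf[c [dc <-] <-] ec]].
    by exists [::].
  exists (rcons ds c); last by rewrite flatten_rcons flatten_cat.
  by move=> b; rewrite mem_rcons inE => /orP[/eqP ->|/hds].
Qed.

(** By [descent_blocksP] the dips are the words re with r in R and e a product of even words of [X].
    Splitting off or absorbing such an e preserves parity, so the two ways of forming blocks
    agree. *)
Lemma blocks_dip_words X : (forall x, X x -> x != [::]) ->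
  blocks (dip_words (blocks X)) = blocks (partial X (blocks X)).
Proof.
move=> X0; rewrite partial_blocksE.
set R := [set w | exists b, descent (blocks X) (narrow X) b w].
have DE w : dip_words (blocks X) w <->
    exists r e, [/\ R r, lang_star (even_part X) e & w = r ++ e].
  split=> [[b /(descent_blocksP _ _ X0)[r [e [hr he ->]]]]|[r [e [[b hr] he ->]]]].
    by exists r, e; split=> //; exists b.
  by exists b; apply/(descent_blocksP _ _ X0); exists r, e.
have EX e : lang_star (even_part X) e -> lang_star (even_part (even_part X `|` R)) e.
  by apply: lang_star_sub => x [Xx ex]; split=> //; left.
apply/seteqP; split=> [_ [d [/DE[r [e [Rr he ->]]] od] [f hf <-]]|
                             _ [o [Ro oo] [f hf <-]]].
- have ee := even_star he.
  rewrite -catA; exists r; first split.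
  + by right.
  + by move: od; rewrite size_cat oddD (negbTE ee) addbF.
  exists (e ++ f) => //; apply: lang_star_cat; first exact: EX.
  elim/lang_star_rind: f / hf => [|u x _ hu [/DE[r' [e' [Rr' he' ->]]] ox]].
    exact: lang_star0.
  apply: lang_star_cat => //; apply: lang_star_cat; last exact: EX.
  apply: lang_star1; split; first by right.
  by move: ox; rewrite size_cat oddD (negbTE (even_star he')) addbF.
- elim/lang_star_rind: f / hf => [|u x _ [d [Dd od] [ds hds def]] [hx ex]].
    rewrite cats0; exists o; last by exists [::]; rewrite ?cats0 //; exact: lang_star0.
    split=> //; case: Ro => [[_]|Ro]; first by rewrite oo.
    by apply/DE; exists o, [::]; rewrite cats0; split=> //; exact: lang_star0.
  rewrite catA -def -catA; case: hx => [Ex|Rx]; last first.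
    exists d => //; exists (ds ++ x) => //; apply: lang_star_cat => //; apply: lang_star1.
    by split=> //; apply/DE; exists x, [::]; rewrite cats0; split=> //; exact: lang_star0.
  (* An even code word is absorbed by the dip before it. *)
  have Dcat c : dip_words (blocks X) c -> dip_words (blocks X) (c ++ x).
    move=> /DE[r [e [Rr he ->]]]; apply/DE; exists r, (e ++ x); rewrite catA; split=> //.
    by apply: lang_star_cat => //; exact: lang_star1.
  elim/lang_star_rind: ds / hds {def} => [|v c hv _ [Dc ec]].
    exists (d ++ x); last by exists [::]; rewrite ?cats0 //; exact: lang_star0.
    by split; [exact: Dcat|rewrite size_cat oddD od (negbTE ex)].
  exists d => //; exists (v ++ (c ++ x)); last by rewrite catA.
  apply: lang_star_cat => //; apply: lang_star1; split; first exact: Dcat.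
  by rewrite size_cat oddD (negbTE ec).
Qed.

Lemma nsuperdipE n : @nsuperdip disp A n = blocks (code n).
Proof.
elim: n => [|n IH] /=.
  apply/seteqP; split=> [_ [a _ <-]|_ [_ [[a _ <-] _] [e [s hs <-] <-]]].
    by apply: blocks_odd_part; split=> //; exists a.
  (* No letter has even length, so the starred part is empty. *)
  case: s hs => [|x s hs]; first by rewrite cats0; exists a.
  by have /= := hs x (mem_head _ _); case=> [[b _ <-]].
rewrite IH superdips_flattenE; last exact: odd_blocks.
by rewrite blocks_dip_words //; exact: code_neq0.
Qed.

Lemma ndipE n : @ndip disp A n.+1 = dip_words (blocks (code n)).
Proof.
rewrite /ndip /= nsuperdipE; apply/seteqP; split=> [_ [d /dips_descent[b h] <-]|w [b]].
  by exists b.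
by case/descent_dips=> s [ds <-]; exists (b :: s).
Qed.

(** Elimination puts powers of [u] in front of the other words. Before an even word e, the last [u]
    merges with e into the fresh word ue; before a fresh word or a descent, [u] begins a descent,
    since it exceeds all of [L]. The last hypothesis ensures that no descent is removed together
    with [u]. *)
Lemma partial_elim X L u :
    (forall x, X x -> x != [::]) -> L `<=` blocks X -> (fresh X L `\` L) u ->
    (forall l, L l -> radix_lt l u) ->
    (forall s, blocks X s -> ~ L s -> s = u \/ radix_lt u s) ->
    ~ (exists b, descent L (narrow X) b u) ->
  lazard_elim (partial X L) u = partial X (L `|` [set u]).
Proof.
move=> X0 LS Fu Lu Su Gu; set L' := L `|` [set u].
have Bu : blocks X u by exact: fresh_blocks LS Fu.1.
have L'S : L' `<=` blocks X by move=> x [/LS //|->].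
have L'u x : L' x -> radix_ge u x.
  by case=> [/Lu h|->]; rewrite /radix_ge ?eqxx // h orbT.
have L'lt x : blocks X x -> ~ L' x -> radix_lt u x.
  move=> Bx nx; case: (Su x Bx) => //; first by move=> Lx; apply: nx; left.
  by move=> e; case: nx; right.
have ltL' x : radix_lt u x -> ~ L' x.
  move=> ux [/Lu /radix_asym|e]; first by rewrite ux.
  by move: ux; rewrite e (negbTE (radix_irr _)).
have geL' x : blocks X x -> radix_ge u x -> L' x.
  by move=> Bx; rewrite radix_geP => h; apply: contrapT => /(L'lt _ Bx); apply/negP.
have G_cons b w : descent L' (narrow X) b w -> descent L' (narrow X) u (u ++ w).
  move=> h; apply: (descent_step _ _ h); first by right.
  by apply: L'u; exact: descent_head h.
have G_base v : fresh X L' v -> ~ L' v -> descent L' (narrow X) u (u ++ v).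
  move=> Fv nv; apply: descent_base; first by right.
    case: Fv => [|[p Lp [e Ee <-]]]; first by left.
    by right; exists p; [split; [exact: L'S|exact: L'u]|exists e].
  by apply: L'lt nv; exact: fresh_blocks Fv.
(* A descent whose head lies in [L] cannot reach [u], which is greater. *)
have G_low b w : descent L' (narrow X) b w -> L b -> descent L (narrow X) b w.
  elim=> [x v _ Qv xv Lx|c x w' _ cx h IH Lc]; first exact: descent_base.
  apply: descent_step (IH _) => //.
  case: (descent_head h) => // e.
  by move: cx; rewrite radix_geP e Lu.
have G_pow j b w : descent L' (narrow X) b w ->
    exists b', descent L' (narrow X) b' (flatten (nseq j u) ++ w).
  move=> h; elim: j => [|j [b' IH]] /=; first by exists b.
  by exists u; rewrite -catA; exact: G_cons IH.
apply/seteqP; split=> w.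
- case/lang_elimP=> j [x [-> Px xu]].
  have F'P i v : fresh X L' v -> ~ L' v -> partial X L' (flatten (nseq i u) ++ v).
    case: i => [|i] Fv nv; first by left; right.
    have := G_pow i _ _ (G_base _ Fv nv); rewrite catA => -[b hb].
    right; exists b; move: hb; rewrite -[i.+1]addn1 nseqD flatten_cat /=.
    by rewrite cats0.
  case: Px => [[Ex|[Fx nx]]|[b Gx]].
  + case: j => [|j]; first by left; left.
    (* One copy of [u] is set aside and joined to the even word [x]. *)
    rewrite -[j.+1]addn1 nseqD flatten_cat /= cats0 -catA.
    apply: F'P; first by right; exists u; [right|exists x].
    by apply/ltL'/radix_cat/X0; case: Ex.
  + apply: F'P; last by case.
    by case: Fx => [Ox|[p Lp [e Ee <-]]]; [left|right; exists p; [left|exists e]].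
  + right; apply: (G_pow j b).
    by apply: descent_sub Gx => [y Ly|y v //]; left.
- have elim_pow i v : lazard_elim (partial X L) u v ->
      lazard_elim (partial X L) u (flatten (nseq i u) ++ v).
    case/lang_elimP=> j [x [-> Px xu]]; apply/lang_elimP; exists (i + j), x.
    by rewrite nseqD flatten_cat catA.
  have F'P v : fresh X L' v -> ~ L' v -> lazard_elim (partial X L) u v.
    move=> Fv nv; apply/lang_elimP.
    have nLv : ~ L v by move=> Lv; apply: nv; left.
    have vu : v <> u by move=> e; apply: nv; right.
    case: Fv => [Ov|[p [Lp|->] [e Ee ev]]].
    + by exists 0, v; split=> //; left; right; split=> //; left.
    + exists 0, v; split=> //; left; right; split=> //.
      by right; exists p => //; exists e.
    + exists 1, e; rewrite /= cats0 ev; split=> //; first by left; left.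
      by move=> eu; have := odd_blocks Bu; rewrite -eu; apply/negP; case: Ee.
  case=> [[Ew|[]]|[b]].
  + apply/lang_elimP; exists 0, w; split=> //; first by left; left.
    by move=> wu; have := odd_blocks Bu; rewrite -wu; apply/negP; case: Ew.
  + exact: F'P.
  + elim=> [x v L'x Qv xv|c x w' L'c cx h IH]; last first.
      case: (L'c) => [Lc|->]; last by have := elim_pow 1 _ IH; rewrite /= cats0.
      have := G_low _ _ (descent_step L'c cx h) Lc => G.
      apply/lang_elimP; exists 0, (c ++ w'); split=> //; first by right; exists c.
      by move=> e; apply: Gu; exists c; rewrite -e.
    case: (L'x) => [Lx|ex].
      have G := descent_base Lx Qv xv.
      apply/lang_elimP; exists 0, (x ++ v); split=> //; first by right; exists x.
      by move=> e; apply: Gu; exists x; rewrite -e.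
    rewrite ex in Qv xv *.
    have := elim_pow 1 v; rewrite /= cats0; apply; apply: F'P; last exact: ltL'.
    (* A parent of [v] is at most [u] by [narrow], hence lies in [L']. *)
    case: Qv => [|[p [Bp up] [e Ee <-]]]; first by left.
    by right; exists p; [exact: geL'|exists e].
Qed.

(** * Lengths and indices of dips and superdips *)

Lemma descent_prefix L Q b w : descent L Q b w -> exists r, w = b ++ r.
Proof. by case=> [x v _ _ _|c x w' _ _ _]; eexists. Qed.

Lemma dip_words_two L w : dip_words L w ->
  exists a b r, [/\ L a, L b & w = a ++ (b ++ r)].
Proof.
case=> c; case=> [x v Lx Lv _|b x w' Lb _ h].
  by exists x, v, [::]; rewrite cats0.
have [r def_w] := descent_prefix h.
by exists b, x, r; rewrite -def_w; split=> //; exact: descent_head h.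
Qed.

Lemma nsuperdipS n : @nsuperdip disp A n.+1 = blocks (@ndip disp A n.+1).
Proof.
by rewrite ndipE blocks_dip_words ?nsuperdipE //; exact: code_neq0.
Qed.

(** Descend the levels: a k-dip starts with two (k-1)-superdips, and the first of these starts with
    a (k-1)-dip as long as n < k - 1. *)
Lemma ndip_two n k w : n < k -> @ndip disp A k w ->
  exists a b r, [/\ @nsuperdip disp A n a, nsuperdip n b & w = a ++ (b ++ r)].
Proof.
elim: k w => // k IH w; rewrite ltnS leq_eqVlt => /orP[/eqP <-|].
  by rewrite ndipE -nsuperdipE; exact: dip_words_two.
case: k IH => // k IH nk; rewrite ndipE -nsuperdipE => /dip_words_two[c [c' [r]]].
rewrite nsuperdipS => -[[o [Do _] [f _ <-]] _ ->].
have [a [b [r' [Sa Sb ->]]]] := IH _ nk Do.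
by exists a, b, (r' ++ f ++ c' ++ r); rewrite !catA.
Qed.

Lemma ndip_level_two n k w : n < k -> @ndip_level disp A k w ->
  exists a b r, [/\ @nsuperdip disp A n a, nsuperdip n b & w = a ++ (b ++ r)].
Proof.
move=> nk [_ [[|d s] [// _ hs] <-] [p _ <-]].
have /(ndip_two nk)[a [b [r [Sa Sb ->]]]] : ndip k d by apply: hs; rewrite /= inE eqxx.
by exists a, b, (r ++ flatten s ++ p); rewrite /= !catA.
Qed.

(** An (n+1)-superdip begins with two n-superdips. The bound makes the index a true maximum and
    stops the climb through the levels. *)
Lemma nsuperdip_size n w : @nsuperdip disp A n w -> n < size w.
Proof.
elim: n w => [|n IH] w; first by case=> a _ <-.
rewrite nsuperdipS => -[o [Do _] [e _ <-]].
have [a [b [r [/IH na /IH nb ->]]]] := ndip_two (ltnSn n) Do.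
by rewrite !size_cat; apply: leq_trans (leq_addr _ _); rewrite -[n.+2]addn1;
  apply: leq_add => //; apply: leq_trans (leq_addr _ _); exact: leq_ltn_trans nb.
Qed.

Lemma ndip_level_size k w : 0 < k -> @ndip_level disp A k w -> k <= size w.
Proof.
case: k => // k _ /(ndip_level_two (ltnSn k))[a [b [r [/nsuperdip_size ka _ ->]]]].
by rewrite size_cat; apply: leq_trans (leq_addr _ _).
Qed.

Lemma word_index_ge k w : 0 < k -> @ndip_level disp A k w -> k <= word_index w.
Proof.
move=> k0 kw; rewrite /word_index; case: xgetP => [n _ [_ _ h]|h]; first exact: h.
pose P j := (0 < j) && `[< @ndip_level disp A j w >].
have exP : exists j, P j by exists k; rewrite /P k0; apply/asboolP.
have bP j : P j -> j <= size w by case/andP=> j0 /asboolP; exact: ndip_level_size.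
case: (ex_maxnP exP bP) => j /andP[j0 /asboolP jw] jmax.
case: (h j); split=> // i i0 iw; apply: jmax; rewrite /P i0; exact/asboolP.
Qed.

(** For n = 0 the first hypothesis is void, and the value is the default of [xget]. *)
Lemma word_index_eq n w : (0 < n -> @ndip_level disp A n w) ->
  (forall k, n < k -> ~ @ndip_level disp A k w) -> word_index w = n.
Proof.
move=> nw nk; rewrite /word_index; case: xgetP => [j _ [j0 jw jmax]|h].
  apply/eqP; rewrite eqn_leq; apply/andP; split.
    by rewrite leqNgt; apply/negP => /nk.
  by case: n nw {nk} => // n nw; apply: jmax => //; exact: nw.
case: n nw nk h => // n nw nk h; case: (h n.+1); split=> //; first exact: nw.
by move=> k _ kw; rewrite leqNgt; apply/negP => /nk.
Qed.

Lemma ndip_ndip_level n w : lang_plus (@ndip disp A n) w ->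
  (exists d, @ndip disp A n d /\ d != [::]) -> ndip_level n w.
Proof.
move=> hw [d [dd d0]]; exists w => //; exists [::]; rewrite ?cats0 //.
by exists d => //; rewrite prefix0s eq_sym.
Qed.

Lemma ndip_neq0 n w : @ndip disp A n.+1 w -> w != [::].
Proof. by rewrite ndipE => -[b]; exact: descent_neq0. Qed.

Lemma nsuperdip_level n w : 0 < n -> @nsuperdip disp A n w -> ndip_level n w.
Proof.
case: n => // n _; rewrite nsuperdipS => -[o [Do _] [_ [s hs <-] <-]].
apply: ndip_ndip_level; last by exists o; split=> //; exact: ndip_neq0 Do.
exists (o :: s) => //; split=> // x /=; rewrite inE => /orP[/eqP -> //|/hs].
by case.
Qed.

(** This puts the descents of [partial], which are (n+1)-dips, after the n-superdips of index n: an
    odd descent by its index, an even one by its parity. *)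
Lemma ndip_index_gt n w : @ndip disp A n.+1 w -> n < word_index w.
Proof.
move=> dw; apply: word_index_ge => //; apply: ndip_ndip_level.
  exists [:: w]; rewrite /= ?cats0 //; split=> // x /=.
  by rewrite inE => /eqP ->.
by exists w; split=> //; exact: ndip_neq0 dw.
Qed.

(* Prefix-freeness aligns the two factorisations of [w] over the code, and then
   the odd factor opening the second superdip faces an even factor of [w]. *)
Lemma nsuperdip_not_level N n k w : prefix_free_upto N (code n) -> n < k ->
  @nsuperdip disp A n w -> size w <= N -> ~ @ndip_level disp A k w.
Proof.
move=> pX nk; rewrite nsuperdipE => -[o [Xo oo] [_ [es hes <-] <-]] wN.
case/(ndip_level_two nk)=> a [b [r]]; rewrite nsuperdipE.
case=> -[oa [Xoa _] [_ [ea hea <-] <-]] [ob [Xob oob] [fb _ <-]].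
move=> e.
have [||||| s'] := @prefix_free_flatten _ N (code n) (o :: es)
  ((oa :: ea) ++ [:: ob]) (fb ++ r) _ pX.
- exact: code_neq0.
- by move=> x /=; rewrite inE => /orP[/eqP -> //|/hes[]].
- by move=> x /=; rewrite inE mem_cat inE => /or3P[/eqP -> //|/hea[]//|/eqP ->].
- by [].
- by rewrite /= e flatten_cat /= cats0 -!catA.
rewrite -catA => -[_ def_es]; suff /hes[_] : ob \in es by rewrite oob.
by rewrite def_es mem_cat inE eqxx orbT.
Qed.

Lemma nsuperdip_index N n w : prefix_free_upto N (code n) ->
  @nsuperdip disp A n w -> size w <= N -> word_index w = n.
Proof.
move=> pX Sw wN; apply: word_index_eq => [n0|k nk]; first exact: nsuperdip_level.
exact: nsuperdip_not_level pX nk Sw wN.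
Qed.

Lemma descent_ndip n L b w : L `<=` blocks (code n) ->
  descent L (narrow (code n)) b w -> @ndip disp A n.+1 w.
Proof.
move=> LS h; rewrite ndipE; exists b; apply: descent_sub h => // x v.
exact: narrow_blocks.
Qed.

(** * Words of bounded length and the invariant of the elimination *)

Lemma radix_ge_size u v : radix_ge u v -> size v <= size u.
Proof.
by case/orP=> [/eqP -> //|/orP[/ltnW //|/andP[/eqP -> _]]].
Qed.

Lemma radix_ge_trans u v w : radix_ge u v -> radix_ge v w -> radix_ge u w.
Proof.
case/orP=> [/eqP -> //|vu] /orP[/eqP <-|wv]; rewrite /radix_ge ?vu ?orbT //.
by rewrite (radix_trans wv vu) orbT.
Qed.

(** Drop even factors from the right until the next shorter block is in [L] or only the odd factor
    is left. *)
Lemma least_fresh X L s : (forall x, X x -> x != [::]) -> blocks X s -> ~ L s ->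
  exists s', (fresh X L `\` L) s' /\ radix_ge s s'.
Proof.
move=> X0 [o Xo [es hes <-]]; elim/lang_star_rind: es / hes => [|es e hes IH Ee].
  by rewrite cats0 => no; exists o; split; [split=> //; left|rewrite /radix_ge eqxx].
rewrite catA => nL; case: (pselect (L (o ++ es))) => [Le|/IH[s' [Fs' ge_s']]].
  exists ((o ++ es) ++ e); split; last by rewrite /radix_ge eqxx.
  by split=> //; right; exists (o ++ es) => //; exists e.
exists s'; split=> //; apply: radix_ge_trans ge_s'.
by rewrite /radix_ge radix_cat ?orbT //; case: Ee => /X0.
Qed.

Lemma lang_elim_upto N X Y z :
    (forall w, size w <= N -> X w <-> Y w) ->
  forall w, size w <= N -> lazard_elim X z w <-> lazard_elim Y z w.
Proof.
move=> XY w wN; split=> /lang_elimP[j [x [def_w Xx xz]]]; apply/lang_elimP;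
  exists j, x; split=> //; apply/XY => //; apply: leq_trans wN;
  by rewrite def_w size_cat leq_addl.
Qed.

Lemma descent_upto N L X b w : blocks X `&` @words_upto A N `<=` L ->
  size w <= N -> descent (blocks X) (narrow X) b w -> descent L (narrow X) b w.
Proof.
move=> SL wN h; elim: h wN => [x v Sx Qv xv|c x w' Sc cx _ IH];
  rewrite size_cat => wN.
- apply: descent_base => //; apply: SL; split=> //.
  by apply: leq_trans wN; exact: leq_addr.
- apply: descent_step (IH _) => //; last by apply: leq_trans wN; exact: leq_addl.
  by apply: SL; split=> //; apply: leq_trans wN; exact: leq_addr.
Qed.

(* [Y] is a stage of the elimination along [Z], considered on words of length
   at most [N], in which all k-superdips with k < n and the n-superdips in [L]
   have been eliminated. *)
Definition reached N (Z Y : set word) n L : Prop :=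
  [/\ prefix_free_upto N (code n), L `<=` blocks (code n),
      forall s l, blocks (code n) s -> ~ L s -> L l -> radix_lt l s,
      forall w, size w <= N -> Y w <-> partial (code n) L w &
      L `<=` Z /\ forall k w, k < n -> blocks (code k) w -> size w <= N -> Z w].

(** With the short blocks exhausted, no short fresh word remains and short descents over all blocks
    are descents over [L]. Prefix-freeness of the next code is inherited from the actual stage
    [Y]. *)
Lemma reached_next N Z Y n L : prefix_free Y -> reached N Z Y n L ->
  blocks (code n) `&` @words_upto A N `<=` L -> reached N Z Y n.+1 set0.
Proof.
move=> pY [pX LS Llt YE [LZ lowZ]] SL.
have YE' w : size w <= N -> Y w <-> code n.+1 w.
  move=> wN; rewrite YE // /= partial_blocksE; split=> -[].
  + case=> [Ew|[Fw nw]]; first by left.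
    by case: nw; apply: SL; split=> //; exact: fresh_blocks Fw.
  + by case=> b h; right; exists b; apply: (descent_sub LS _ h) => x v.
  + by move=> Ew; left; left.
  + by case=> b h; right; exists b; exact: descent_upto SL wN h.
split=> //.
- move=> x y Xx Xy yN xy; have xN : size x <= N by apply: leq_trans (size_prefix xy) yN.
  by apply: pY xy; apply/YE'.
- by move=> w wN; rewrite YE' // partial0.
- split=> // k w; rewrite ltnS leq_eqVlt => /orP[/eqP -> Sw wN|]; last exact: lowZ.
  by apply/LZ/SL.
Qed.

(** While a short block is left, so is a fresh word, odd and of index n; it would precede [z] if [z]
    were even or a descent. So [z] is fresh, and at equal parity and index [prec] is the radix
    order, which makes [z] the least remaining block. *)
Lemma reached_elim N Z Y n L z s :
    reached N Z Y n L -> Y z -> Z z -> size z <= N ->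
    (forall x, Y x -> size x <= N -> x = z \/ prec z x) ->
    blocks (code n) s -> size s <= N -> ~ L s ->
  nsuperdip n z /\ reached N Z (lazard_elim Y z) n (L `|` [set z]).
Proof.
move=> [pX LS Llt YE [LZ lowZ]] Yz Zz zN zmin Ss sN nLs.
have Fmin t : blocks (code n) t -> size t <= N -> ~ L t ->
    exists t', [/\ (fresh (code n) L `\` L) t', radix_ge t t', word_index t' = n &
                   t' = z \/ prec z t'].
  move=> St tN nLt; have [t' [Ft ge_t]] := least_fresh (@code_neq0 n) St nLt.
  have tN' : size t' <= N by apply: leq_trans (radix_ge_size ge_t) tN.
  exists t'; split=> //.
    apply: (nsuperdip_index pX) => //; rewrite nsuperdipE; exact: fresh_blocks LS Ft.1.
  by apply: zmin => //; apply/YE => //; left; right.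
have Fodd t : (fresh (code n) L `\` L) t -> odd (size t).
  by case=> /(fresh_blocks LS)/odd_blocks.
have Fz : (fresh (code n) L `\` L) z.
  have [s' [Fs' _ ns' zs']] := Fmin s Ss sN nLs.
  have [[[_ ez]|//]|[b /(descent_ndip LS)/ndip_index_gt nz]] := (YE _ zN).1 Yz.
    case: zs' => [e|]; first by move: ez; rewrite -e Fodd.
    by rewrite /prec (Fodd _ Fs') (negbTE ez).
  case: zs' => [e|]; first by move: nz; rewrite -e ns' ltnn.
  rewrite /prec (Fodd _ Fs') andbF ns' /= => /andP[_ /orP[|/andP[/eqP e _]]].
    by rewrite ltnNge (ltnW nz).
  by move: nz; rewrite e ltnn.
have Sz : blocks (code n) z by exact: fresh_blocks LS Fz.1.
have nz : word_index z = n by apply: (nsuperdip_index pX) => //; rewrite nsuperdipE.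
have zle t : blocks (code n) t -> ~ L t -> t = z \/ radix_lt z t.
  (* Blocks longer than [N] exceed [z] by length alone. *)
  move=> St nLt; case: (leqP (size t) N) => tN; last first.
    by right; rewrite /radix_lt (leq_ltn_trans zN tN).
  have [t' [Ft' ge_t nt' zt']] := Fmin t St tN nLt.
  have : radix_ge t z.
    apply: radix_ge_trans ge_t _; case: zt' => [->|]; first by rewrite /radix_ge eqxx.
    rewrite /prec (Fodd _ Ft') andbF nt' nz ltnn eqxx /= => /andP[_ h].
    by rewrite /radix_ge h orbT.
  by case/orP=> [/eqP|]; [left|right].
rewrite nsuperdipE; split=> //; split=> //.
- by move=> x [/LS //|->].
- move=> t l St nt [Ll|->].
    by apply: Llt => // Lt; apply: nt; left.
  case: (zle t St) => // [Lt|e]; first by apply: nt; left.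
  by case: nt; right.
- move=> w wN; rewrite (lang_elim_upto _ YE) // partial_elim //.
  + exact: code_neq0.
  + by move=> l Ll; apply: Llt Ll => //; case: Fz.
  + by case=> b /(descent_ndip LS)/ndip_index_gt; rewrite nz ltnn.
- by split=> // x [/LZ //|->].
Qed.

(** Caps the level by the length of any odd word still present. *)
Lemma partial_odd_size n L w : L `<=` blocks (code n) ->
  partial (code n) L w -> odd (size w) -> n < size w.
Proof.
move=> LS [[[_ /negbTE -> //]|[/(fresh_blocks LS) Sw _]]|[b h]] _.
  by apply: nsuperdip_size; rewrite nsuperdipE.
case: (ndip_two (ltnSn n) (descent_ndip LS h)) => a [c [r [/nsuperdip_size na _ ->]]].
by rewrite size_cat; apply: leq_trans na (leq_addr _ _).
Qed.

Lemma lazard_stageS (zs : seq word) i : i < size zs ->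
  lazard_stage zs i.+1 = lazard_elim (lazard_stage zs i) (nth [::] zs i).
Proof. by move=> iz; rewrite /lazard_stage (take_nth [::]) // foldl_rcons. Qed.

Lemma prefix_free_letters : prefix_free (@letters A).
Proof. by move=> _ _ [a _ <-] [b _ <-] /=; rewrite andbT => /eqP ->. Qed.

Lemma reached0 N Z : reached N Z (lazard_stage [::] 0) 0 set0.
Proof.
split=> // [x y||]; last by split.
  by move=> Xx Xy _; exact: prefix_free_letters.
by move=> w _; rewrite partial0.
Qed.

End Blocks.

(** * The elimination along [Z] on words of length at most [m] *)

Theorem theorem25 (disp : Order.disp_t) (A : finOrderType disp)
    (hA : 1 < #|A|) (Z : set (seq A)) (hZ : lazard_set (@prec disp A) Z)
    (m : nat) (hm : odd m) :
  (\bigcup_n @nsuperdip disp A n) `&` @words_of_length A m =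
  Z `&` @words_of_length A m.
Proof.
have [Z0 [_ prec_trans _] /(_ m)] := hZ.
case=> [|zs [zsE zs_sorted zs_stage zs_end]]; first by case: (m) hm.
pose st i := lazard_stage zs i.
pose z i := nth [::] zs i.
have zs_mem x : x \in zs -> Z x /\ size x <= m.
  by move=> xs; have : [set` zs] x := xs; rewrite zsE.
have zZ i : i < size zs -> Z (z i) /\ size (z i) <= m.
  by move=> iz; apply/zs_mem/mem_nth.
have stS i : i < size zs -> st i.+1 = lazard_elim (st i) (z i) by exact: lazard_stageS.
have z_prec i j : i < j -> j < size zs -> prec (z i) (z j).
  move=> ij jz; pose P : {pred seq A} := fun x => `[< Z x >].
  have tr : {in P & &, transitive (@prec disp A)}.
    by move=> y x w /asboolP Zy /asboolP Zx /asboolP Zw; exact: prec_trans.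
  apply: (sorted_ltn_nth_in tr) => //; last exact: ltn_trans jz.
  by apply/allP => x /zs_mem[Zx _]; apply/asboolP.
have later i x : i <= size zs -> st i x -> size x <= m ->
    exists j, [/\ i <= j, j < size zs & x = z j].
  (* Induction on the number of eliminations to come: a word other than [z k] survives with exponent
     0, and nothing short is left at the end. *)
  move=> iz; rewrite -(subKn iz); move: (size zs - i) (leq_subr i (size zs)) => d.
  elim: d x => [|d IH] x dz Yx xm.
    suff : set0 x by [].
    by rewrite -zs_end; split=> //; move: Yx; rewrite subn0.
  set k := size zs - d.+1 in Yx *.
  have kz : k < size zs by rewrite /k; lia.
  have kS : size zs - d = k.+1 by rewrite /k; lia.
  case: (x =P z k) => [->|xz]; first by exists k.
  have [|j [kj jz ->]] := IH x (ltnW dz) _ xm.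
    rewrite kS stS //; by apply/lang_elimP; exists 0, x.
  by exists j; split=> //; move: kj; rewrite kS; exact: ltnW.
have z_min i x : i < size zs -> st i x -> size x <= m -> x = z i \/ prec (z i) x.
  move=> iz Yx xm; have [j [ij jz ->]] := later i x (ltnW iz) Yx xm.
  move: ij; rewrite leq_eqVlt => /orP[/eqP ->|ij]; [by left|right; exact: z_prec].
have st_pf i : i <= size zs -> prefix_free (st i).
  elim: i => [_|i IH iz].
    by rewrite /st /lazard_stage take0; exact: prefix_free_letters.
  by rewrite stS //; apply: prefix_free_elim; [exact: zs_stage|exact/IH/ltnW].
pose S n := blocks (@code disp A n).
have advance i n L : i <= size zs -> reached m Z (st i) n L ->
    (exists s, [/\ S n s, size s <= m & ~ L s]) \/ reached m Z (st i) n.+1 set0.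
  move=> iz R; case: (pselect (exists s, [/\ S n s, size s <= m & ~ L s])) => h.
    by left.
  right; apply: reached_next (st_pf i iz) R _ => s [Ss sm].
  by apply: contrapT => nLs; apply: h; exists s.
(* Raise the level until a short block is left; this stops because the odd word [z i], of length at
   most [m], is longer than the level. *)
have normal i n L : i < size zs -> odd (size (z i)) -> reached m Z (st i) n L ->
    exists n' L', reached m Z (st i) n' L' /\
      exists s, [/\ S n' s, size s <= m & ~ L' s].
  move=> iz oz; move: (leqnn (m - n)); move: {2}(m - n) => d.
  elim: d n L => [|d IH] n L dn R; case: (advance i n L (ltnW iz) R) => [h|R'];
    try by exists n, L.
  - case: R => _ LS _ YE _; have [_ zm] := zZ i iz.
    have := partial_odd_size LS ((YE _ zm).1 (zs_stage i iz)) oz; lia.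
  - case: R => _ LS _ YE _; have [_ zm] := zZ i iz.
    have := partial_odd_size LS ((YE _ zm).1 (zs_stage i iz)) oz => nz.
    by apply: IH R'; lia.
have step i n L : i < size zs -> odd (size (z i)) -> reached m Z (st i) n L ->
    exists n' L', nsuperdip n' (z i) /\ reached m Z (st i.+1) n' L'.
  move=> iz oz /(normal _ _ _ iz oz)[n' [L' [R [s [Ss sm nLs]]]]].
  have [Zz zm] := zZ i iz; exists n', (L' `|` [set z i]); rewrite stS //.
  by apply: reached_elim Ss sm nLs => // [|x]; [exact: zs_stage|exact: z_min].
have reach i : i <= size zs -> (forall j, j < i -> odd (size (z j))) ->
    exists n L, reached m Z (st i) n L.
  elim: i => [_ _|i IH iz oz].
    by exists 0, set0; rewrite /st /lazard_stage take0; exact: reached0.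
  have [|n [L R]] := IH (ltnW iz); first by move=> j ji; apply: oz; exact: ltnW.
  by have [n' [L' [_ R']]] := step i n L iz (oz i (ltnSn i)) R; exists n', L'.
apply/seteqP; split=> w [].
- case=> k _ Sw /= wm; split=> //.
  (* The first even word of [zs], or [size zs] if there is none. *)
  pose i := find (fun x : seq A => ~~ odd (size x)) zs.
  have iz : i <= size zs by exact: find_size.
  (* Such an [x] would come after the even word [z i], against [prec]. *)
  have noodd x : st i x -> size x <= m -> ~ odd (size x).
    move=> Yx xm ox; have [j [ij jz def_x]] := later i x iz Yx xm.
    have iz' : i < size zs by exact: leq_ltn_trans jz.
    have ei : ~~ odd (size (z i)) 
      by have := iz'; rewrite -has_find; exact: (nth_find [::]).
    move: ij; rewrite leq_eqVlt => /orP[/eqP ij|ij].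
      by move: ei; rewrite ij -def_x ox.
    by have := z_prec i j ij jz; rewrite /prec -def_x ox (negbTE ei).
  have {}reach : exists n L, reached m Z (st i) n L.
    by apply: reach => // j /(before_find [::])/negbFE.
  (* At this fixed stage the level can be raised past k, since a remaining short block would give an
     odd word in the stage. The invariant then puts the short k-superdips in [Z]. *)
  have [n [L [kn [_ _ _ _ [_]]]]] : exists n L, k.+1 <= n /\ reached m Z (st i) n L.
    move: reach; elim: k.+1 => [[n [L R]]|d IH /IH[n [L [dn R]]]].
      by exists n, L.
    exists n.+1, set0; split=> //.
    case: (advance i n L iz R) => // -[s [Ss sm nLs]].
    have [s' [Fs' ge_s]] := least_fresh (@code_neq0 _ A n) Ss nLs.
    have sm' : size s' <= m by apply: leq_trans (radix_ge_size ge_s) sm.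
    case: R => _ LS _ YE _.
    case: (noodd s') => //; first by apply/YE => //; left; right.
    by apply: odd_blocks; exact: fresh_blocks LS Fs'.1.
  by move=> /(_ k w kn); rewrite -nsuperdipE wm; apply.
- move=> Zw /= wm; split=> //.
  have : [set` zs] w by rewrite zsE; split=> //=; rewrite /words_upto /= wm.
  move=> /= /(nthP [::])[i iz def_w].
  (* [prec] never puts an even word before an odd one, so [reach] and [step] apply up to [w]. *)
  have oz j : j <= i -> odd (size (z j)).
    rewrite leq_eqVlt => /orP[/eqP ->|ji]; first by rewrite /z def_w wm.
    have := z_prec j i ji iz; rewrite /prec {2 4 6}/z def_w wm hm.
    by case: (odd (size (z j))).
  have [n [L R]] := reach i (ltnW iz) (fun j ji => oz j (ltnW ji)).
  have [n' [L' [Sz _]]] := step i n L iz (oz i (leqnn i)) R.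
  by exists n' => //; rewrite -def_w.
Qed.
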